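(* Let $p$ be an odd prime and let $n$ be an integer such that $n=-1$ or $n\geq 2$, and assume that $n$ is a quadratic nonresidue modulo $p$. Let $\mathbb{F}_{p^2}=\mathbb{F}_p(\sqrt{n})$, let $N:\mathbb{F}_{p^2}^{*}\to\mathbb{F}_p^{*}$ be the norm map $N(a+b\sqrt{n})=a^2-nb^2$, and let $u=a+b\sqrt{n}\in\mathbb{F}_{p^2}^{*}$ with $a,b\in\mathbb{F}_p$. Then $u$ is a generator of the cyclic group $\mathbb{F}_{p^2}^{*}$ if and only if both of the following hold: $N(u)=a^2-nb^2$ is a generator of $\mathbb{F}_p^{*}$ (i.e. a primitive root modulo $p$), and $\frac{u^2}{N(u)}$ is a generator of the group $\ker N$.
   Context: $\mathbb{F}_p$ is the field of integers modulo the prime $p$. An integer $n$ is a quadratic nonresidue modulo $p$ if there is no integer $a$ with $n\equiv a^2 \pmod p$. For such $n$ (with $p$ odd), $\mathbb{F}_p(\sqrt{n})$ is the quadratic extension of $\mathbb{F}_p$ obtained by adjoining a square root $\sqrt{n}$ of the class of $n$; it is a field with $p^2$ elements, denoted $\mathbb{F}_{p^2}$, and each of its elements is uniquely $a+b\sqrt{n}$ with $a,b\in\mathbb{F}_p$. A superscript $*$ denotes the multiplicative group of nonzero elements. The norm map $N$ is a group homomorphism, $\ker N$ is the subgroup of $u\in\mathbb{F}_{p^2}^{*}$ with $N(u)=1$, and $u^2/N(u)$ lies in $\ker N$ for every $u\in\mathbb{F}_{p^2}^{*}$ (here $\mathbb{F}_p\subset\mathbb{F}_{p^2}$). *)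

(* Defs.v *)
From HB Require Import structures.
From mathcomp Require Import all_boot all_order all_algebra all_fingroup.
From mathcomp Require Import all_solvable all_field.
From mathcomp Require Import ring.

Set Implicit Arguments.
Unset Strict Implicit.
Unset Printing Implicit Defensive.

Import Order.TTheory GRing.Theory Num.Theory.
Local Open Scope ring_scope.

Definition quadratic_nonresidue (p : nat) (n : int) : Prop :=
  ~ exists a : int, (n = a ^+ 2 %[mod p])%Z.

Definition quad_poly (p : nat) (n : int) : {poly 'F_p} := 'X^2 - (n%:~R)%:P.

Lemma intr_Fp_eq0 (p : nat) (m : int) :
  prime p -> (m%:~R == 0 :> 'F_p) = (p %| m)%Z.
Proof.
move=> pp; have ch := pchar_Fp pp; rewrite dvdzE /=.
case: m => k /=; first by rewrite -pmulrn (dvdn_pcharf ch).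
by rewrite NegzE mulrNz oppr_eq0 -pmulrn (dvdn_pcharf ch).
Qed.

Lemma quad_poly_mi (p : nat) (n : int) :
  prime p -> quadratic_nonresidue p n ->
  monic_irreducible_poly (quad_poly p n).
Proof.
move=> pp nr; have sz : size (quad_poly p n) = 3 by rewrite size_XnsubC.
split; last exact: monicXnsubC.
apply: cubic_irreducible; first by rewrite sz.
move=> x; apply/negP => /rootP; rewrite /quad_poly !hornerE => /eqP.
rewrite subr_eq0 => /eqP xn; apply: nr; exists (x : nat)%:Z.
apply/eqP; rewrite eqz_mod_dvd -intr_Fp_eq0 // rmorphB rmorphXn /=.
by rewrite -pmulrn natr_Zp xn subrr.
Qed.

(* F_p(sqrt n), realised as the finite field F_p[X]/(X^2 - n). *)
Notation Fp2 pp nr := {poly %/ quad_poly _ _ with quad_poly_mi pp nr}.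

Section QuadraticField.
Variables (p : nat) (n : int) (pp : prime p) (nr : quadratic_nonresidue p n).
Local Notation K := (Fp2 pp nr).
Implicit Types (a b : 'F_p) (z w : K) (u v : {unit K}).

Definition sqrt_n : K := qpolyX (quad_poly p n).

Definition quad_elt a b : K := a%:A + b%:A * sqrt_n.

(* The coefficients of the reduced representative of z in F_p[X]/(X^2 - n)
   are its coordinates in the basis (1, sqrt n). *)
Definition quad_norm z : 'F_p := z`_0 ^+ 2 - n%:~R * z`_1 ^+ 2.

Lemma size_quad_poly : size (quad_poly p n) = 3.
Proof. by rewrite size_XnsubC. Qed.

Lemma mk_quad_poly : mk_monic (quad_poly p n) = quad_poly p n.
Proof. exact: (mk_monicE (quad_poly_mi pp nr)). Qed.

Lemma sqrt_nE : sqrt_n = 'X :> {poly 'F_p}.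
Proof. by apply: qpolyXE; rewrite ?size_quad_poly ?monicXnsubC. Qed.

Lemma sqrt_n_sqr : sqrt_n ^+ 2 = n%:~R.
Proof.
set h := quad_poly p n.
have h0 : in_qpoly h h = 0.
  by apply/val_inj; rewrite /= mk_quad_poly Pdiv.RingMonic.rmodpp ?monicXnsubC.
have hE : h = 'X^2 - n%:~R by rewrite /h /quad_poly rmorph_int.
have := congr1 (in_qpoly h) hE; rewrite h0 rmorphB rmorphXn rmorph_int.
by move=> /esym/eqP; rewrite subr_eq0 => /eqP.
Qed.

Lemma quad_eltE a b : quad_elt a b = a%:P + b *: 'X :> {poly 'F_p}.
Proof.
rewrite /quad_elt mulr_algl.
set q : {poly %/ quad_poly p n} := a *: 1 + b *: qpolyX (quad_poly p n).
rewrite -[LHS]/(polyn q) poly_of_qpolyD !poly_of_qpolyZ.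
by rewrite -/sqrt_n sqrt_nE /= alg_polyC.
Qed.

Lemma coef_quad_elt a b : ((quad_elt a b)`_0 = a) * ((quad_elt a b)`_1 = b).
Proof. by rewrite quad_eltE !coefE /= !(mulr0, mulr1, addr0, add0r). Qed.

Lemma quad_coordK z : quad_elt z`_0 z`_1 = z.
Proof.
apply/val_inj/polyP => i; rewrite -[val (quad_elt _ _)]/(polyn _) quad_eltE.
have sz : (size (polyn z) <= 2)%N.
  by apply: leq_trans (size_npoly z) _; rewrite mk_quad_poly size_quad_poly.
case: i => [|[|i]]; rewrite !coefE /= !(mulr0, mulr1, addr0, add0r) //.
by rewrite nth_default // (leq_trans sz).
Qed.

Lemma quad_norm_elt a b : quad_norm (quad_elt a b) = a ^+ 2 - n%:~R * b ^+ 2.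
Proof. by rewrite /quad_norm !coef_quad_elt. Qed.

Lemma quad_eltM a b c d : quad_elt a b * quad_elt c d =
  quad_elt (a * c + n%:~R * (b * d)) (a * d + b * c).
Proof.
have En : n%:~R = (n%:~R : 'F_p)%:A :> K by rewrite scaler_int.
have E x y : (x * y)%:A = x%:A * y%:A :> K by rewrite mulr_algl scalerA.
rewrite /quad_elt !scalerDl !E -En -sqrt_n_sqr.
ring.
Qed.

Lemma quad_normM z w : quad_norm (z * w) = quad_norm z * quad_norm w.
Proof.
rewrite -(quad_coordK z) -(quad_coordK w) quad_eltM !quad_norm_elt.
ring.
Qed.

Lemma quad_norm1 : quad_norm 1 = 1.
Proof.
have -> : 1 = quad_elt 1 0 by rewrite /quad_elt scale1r scale0r mul0r addr0.
by rewrite quad_norm_elt expr1n expr0n mulr0 subr0.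
Qed.

Lemma quad_norm_unit u : quad_norm (val u) \is a GRing.unit.
Proof.
apply/unitrPr; exists (quad_norm (val u)^-1).
by rewrite -quad_normM divrr ?quad_norm1 // (valP u).
Qed.

Definition unit_norm u : {unit 'F_p} := FinRing.unit 'F_p (quad_norm_unit u).

Lemma unit_normE u a b : val u = a%:A + b%:A * sqrt_n ->
  val (unit_norm u) = a ^+ 2 - n%:~R * b ^+ 2.
Proof. by move=> /= ->; apply: quad_norm_elt. Qed.

Lemma unit_normM : {in [set: {unit K}] &, {morph unit_norm : u v / (u * v)%g}}.
Proof. by move=> u v _ _; apply/val_inj; rewrite /= quad_normM. Qed.

Canonical unit_norm_morphism := Morphism unit_normM.

Lemma unit_incl_proof (c : {unit 'F_p}) : ((val c)%:A : K) \is a GRing.unit.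
Proof. by rewrite (rmorph_unit (in_alg K)) // (valP c). Qed.

Definition unit_incl (c : {unit 'F_p}) : {unit K} :=
  FinRing.unit K (unit_incl_proof c).

End QuadraticField.

Arguments sqrt_n {p n} pp nr.
Arguments unit_norm {p n} pp nr u.
Arguments unit_incl {p n} pp nr c.

(* Main.v *)
(* In the cyclic group of order p^2 - 1 the Frobenius map is conjugation, so
   N(u) = u^(p+1) and u^2 / N(u) = u^(1-p).  Hence the claim says that u has
   order (p+1)(p-1) iff u^(p+1) has order p-1 and u^(p-1) has order p+1. *)
Require Import Defs.
From mathcomp Require Import all_boot all_order all_algebra all_fingroup.
From mathcomp Require Import all_solvable all_field.

Set Implicit Arguments.
Unset Strict Implicit.
Unset Printing Implicit Defensive.

Import Order.TTheory GRing.Theory Num.Theory.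
Local Open Scope ring_scope.

Lemma generator_orderE (gT : finGroupType) (G : {group gT}) (x : gT) :
  generator G x = (x \in G) && (#[x]%g == #|G|).
Proof.
rewrite /generator eq_sym eqEcard cycle_subG orderE eqn_leq.
by case Gx: (x \in G); rewrite //= [in RHS]subset_leq_card // cycle_subG.
Qed.

(** For the converse, the order [m] of the power [x ^+ k] divides that of [x], so [x ^+ m] has order
    [#[x] / m]; this being [k] forces [#[x] = m * k]. No coprimality of [m] and [k] is involved. *)
Lemma order_mulP (gT : finGroupType) (x : gT) (m k : nat) :
    (0 < m)%N -> (0 < k)%N ->
  #[x]%g = (m * k)%N <-> #[x ^+ m]%g = k /\ #[x ^+ k]%g = m.
Proof.
move=> m0 k0; split=> [xE | [xm xk]].
  have [xm xk] : (m %| #[x]%g)%N /\ (k %| #[x]%g)%N.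
    by rewrite xE dvdn_mulr ?dvdn_mull.
  by rewrite !orderXdiv // xE mulKn ?mulnK.
have m_dvd : (m %| #[x]%g)%N by rewrite -xk orderXdvd.
by rewrite -(divnK m_dvd) -orderXdiv // xm mulnC.
Qed.

Section QuadraticExtension.
Variables (p : nat) (n : int) (pp : prime p) (nr : quadratic_nonresidue p n).
Local Notation K := (Fp2 pp nr).
Implicit Types (u : {unit K}) (c : {unit 'F_p}).

Lemma card_unit_Fp : #|[set: {unit 'F_p}]| = p.-1.
Proof. by rewrite card_finField_unit card_Fp. Qed.

Lemma card_unit_Fp2 : #|[set: {unit K}]| = (p.+1 * p.-1)%N.
Proof.
rewrite card_finField_unit card_qfpoly size_quad_poly card_Fp //=.
by rewrite -subn1 -(exp1n 2) subn_sqr subn1 addn1 mulnC.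
Qed.

Lemma expr_Fp2_alg (a : 'F_p) : (a%:A : K) ^+ p = a%:A.
Proof.
by rewrite -(rmorphXn (in_alg K)) /= -[in X in _ ^+ X](card_Fp pp) expf_card.
Qed.

Lemma expr_Fp2_elt (a b : 'F_p) :
  quad_elt pp nr a b ^+ p = a%:A + b%:A * sqrt_n pp nr ^+ p.
Proof.
have chK : p \in [pchar K] by rewrite pchar_lalg pchar_Fp.
rewrite /quad_elt -(pFrobenius_autE chK) rmorphD rmorphM /=.
by rewrite !pFrobenius_autE !expr_Fp2_alg.
Qed.

Lemma expr_sqrt_n : sqrt_n pp nr ^+ p = - sqrt_n pp nr.
Proof.
(* Frobenius fixes the class of [n], so it sends the square root of [n] to plus or minus itself. *)
have: (sqrt_n pp nr ^+ p) ^+ 2 == sqrt_n pp nr ^+ 2.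
  by rewrite exprAC sqrt_n_sqr -scaler_int expr_Fp2_alg.
rewrite eqf_sqr => /orP[/eqP fix_sqrt|/eqP//].
(* Otherwise Frobenius is trivial, so the exponent p^2 - 1 of the cyclic unit
   group divides p - 1. *)
have /cyclicP[g gE] := field_unit_group_cyclic [set: {unit K}]%G.
have : (g ^+ p)%g = (g ^+ 1)%g.
  apply/val_inj; rewrite FinRing.val_unitX expg1 -(quad_coordK (val g)).
  by rewrite expr_Fp2_elt fix_sqrt.
(* Cancelling one factor [g] in [g ^+ p = g] leaves [#[g]] dividing [p.-1]. *)
move/eqP; rewrite -[p in (g ^+ p)%g](prednK (prime_gt0 pp)) -addn1.
rewrite eq_expg_mod_order -[X in _ == X %[mod _]]add0n eqn_modDr mod0n.
have p1_gt0 : (0 < p.-1)%N by rewrite -subn1 subn_gt0 prime_gt1.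
move/(dvdn_leq p1_gt0); rewrite orderE -gE card_unit_Fp2.
by rewrite -[X in (_ <= X)%N]mul1n leq_pmul2r // ltnNge prime_gt0.
Qed.

(** By [expr_sqrt_n], [z ^+ p] is the conjugate of [z], and the product of the two is a difference
    of squares. *)
Lemma quad_norm_expr (z : K) : (quad_norm z)%:A = z ^+ p.+1 :> K.
Proof.
rewrite -(quad_coordK z) exprSr expr_Fp2_elt expr_sqrt_n quad_norm_elt.
have algE (c : 'F_p) : c%:A = in_alg K c by [].
rewrite /quad_elt mulrN mulrC -subr_sqr exprMn sqrt_n_sqr !algE.
by rewrite rmorphB rmorphXn [in LHS]rmorphM rmorphXn rmorph_int.
Qed.

Lemma unit_incl_norm u : unit_incl pp nr (unit_norm pp nr u) = (u ^+ p.+1)%g.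
Proof. by apply/val_inj; rewrite FinRing.val_unitX /= quad_norm_expr. Qed.

Lemma unit_inclM :
  {in [set: {unit 'F_p}] &, {morph unit_incl pp nr : c d / (c * d)%g}}.
Proof.
by move=> c d _ _; apply/val_inj; rewrite /= mulr_algl scalerA.
Qed.

Canonical unit_incl_morphism := Morphism unit_inclM.

(** Injectivity lets orders in the unit group of ['F_p] be computed in that of [K]. *)
Lemma injm_unit_incl : ('injm (unit_incl pp nr))%g.
Proof.
by apply/injmP => c d _ _ /(congr1 val)/= /(fmorph_inj (in_alg K))/val_inj.
Qed.

Lemma order_unit_norm u : #[unit_norm pp nr u]%g = #[u ^+ p.+1]%g.
Proof.
by rewrite -unit_incl_norm -(order_injm injm_unit_incl) ?inE.
Qed.

Lemma ker_unit_normE u :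
  (u \in 'ker (unit_norm pp nr))%g = ((u ^+ p.+1)%g == 1%g).
Proof. by rewrite !inE -order_eq1 order_unit_norm order_eq1. Qed.

(** The norm of a generator [g] has order [p.-1], so the norm is onto; the kernel then has index
    [p.-1] in a group of order [p.+1 * p.-1]. *)
Lemma card_ker_unit_norm : #|('ker (unit_norm pp nr))%g| = p.+1.
Proof.
have /cyclicP[g gE] := field_unit_group_cyclic [set: {unit K}]%G.
have p1_gt0 : (0 < p.-1)%N by rewrite -subn1 subn_gt0 prime_gt1.
have [Ng _] : #[g ^+ p.+1]%g = p.-1 /\ #[g ^+ p.-1]%g = p.+1.
  by apply/order_mulP; rewrite // orderE -gE card_unit_Fp2.
have imE : (unit_norm pp nr @* [set: {unit K}])%g = [set: {unit 'F_p}].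
  apply/eqP; rewrite eqEcard subsetT card_unit_Fp /= -Ng -order_unit_norm.
  by rewrite subset_leq_card // cycle_subG mem_morphim ?inE.
have := Lagrange (subsetT ('ker (unit_norm pp nr))%G).
(* The index of the kernel is the order of the image; the intersection only matches the shape of
   [card_morphim]. *)
rewrite -[X in #|X : _|%g](setIid [set: _]) -card_morphim imE card_unit_Fp.
by rewrite card_unit_Fp2 => /eqP; rewrite eqn_pmul2r // => /eqP.
Qed.

End QuadraticExtension.

Theorem theorem12 (p : nat) (n : int) (p_prime : prime p) (p_odd : odd p)
    (n_range : n = -1 \/ 2 <= n) (n_nonres : quadratic_nonresidue p n)
    (u : {unit Fp2 p_prime n_nonres}) (a b : 'F_p)
    (u_def : val u = a%:A + b%:A * sqrt_n p_prime n_nonres) :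
  generator [set: {unit Fp2 p_prime n_nonres}] u <->
  generator [set: {unit 'F_p}] (unit_norm p_prime n_nonres u) /\
  generator ('ker (unit_norm p_prime n_nonres))
    (u ^+ 2 * (unit_incl p_prime n_nonres (unit_norm p_prime n_nonres u))^-1)%g.
Proof.
have p1_gt0 : (0 < p.-1)%N by rewrite -subn1 subn_gt0 prime_gt1.
have -> : (u ^+ 2 * (unit_incl p_prime n_nonres (unit_norm p_prime n_nonres u))^-1
            = (u ^+ p.-1)^-1)%g.
  (* The norm of [u] is [u ^+ p.+1], and this splitting of the exponent cancels [u ^+ 2]. *)
  have pE : p.+1 = (p.-1 + 2)%N by rewrite addn2 prednK ?prime_gt0.
  by rewrite unit_incl_norm pE expgD invMg mulKVg.
have mem_ker : ((u ^+ p.-1)^-1 \in 'ker (unit_norm p_prime n_nonres))%g.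
  rewrite groupV ker_unit_normE -expgM mulnC -(card_unit_Fp2 p_prime n_nonres).
  by rewrite expg_cardG ?inE.
rewrite !generator_orderE mem_ker !inE orderV order_unit_norm card_unit_Fp //.
rewrite card_unit_Fp2 card_ker_unit_norm /=.
(* Inversion preserves orders, so only the orders of [u], [u ^+ p.+1] and [u ^+ p.-1] remain. *)
have uP := order_mulP u (ltn0Sn p) p1_gt0.
by split=> [/eqP/uP[-> ->] | [/eqP um /eqP uk]]; [|apply/eqP/uP].
Qed.
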